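(* The following statements hold for the root lattices and their duals: (1) For every $n \geq 2$, the root lattice $A_n$ and its dual $A_n^*$ are both simple cyclic lattices of rank $n$ in $\mathbb{R}^{n+1}$. (2) For every $n \geq 2$, the root lattice $D_n$ and its dual $D_n^*$ are both cyclic of full rank in $\mathbb{R}^n$. Further, $D_n$ and $D_n^*$ are simple cyclic if and only if $n$ is odd. (3) The self-dual root lattice $E_8$ is cyclic, but not simple cyclic, in $\mathbb{R}^8$. (4) The root lattices $E_6$ and $E_7$ are non-cyclic sublattices of $E_8$ in $\mathbb{R}^8$.
   Context: A lattice $L \subset \mathbb{R}^m$, not necessarily of full rank, is cyclic in $\mathbb{R}^m$ if $\rho(L) = L$, where $\rho : \mathbb{R}^m \to \mathbb{R}^m$ is the rotation shift $\rho(c_1, c_2, \dots, c_m) = (c_m, c_1, \dots, c_{m-1})$. A cyclic lattice $L \subset \mathbb{R}^m$ of rank $n$ is simple cyclic if there exists $\boldsymbol{a} \in L$ such that $L = \operatorname{span}_{\mathbb{Z}}\{\boldsymbol{a}, \rho(\boldsymbol{a}), \dots, \rho^{n-1}(\boldsymbol{a})\}$. The dual of a lattice $L$ is $L^* = \{\boldsymbol{x} \in \operatorname{span}_{\mathbb{R}} L : \langle \boldsymbol{x}, \boldsymbol{y} \rangle \in \mathbb{Z} \text{ for all } \boldsymbol{y} \in L\}$, with respect to the standard inner product $\langle\cdot,\cdot\rangle$. The root lattices are realized as follows, where $\boldsymbol{e}_i$ are the standard basis vectors and $\boldsymbol{1}_8 \in \mathbb{R}^8$ is the all-ones vector: $A_n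 = \{\boldsymbol{x} \in \mathbb{Z}^{n+1} : \sum_{i=1}^{n+1} x_i = 0\}$; $D_n = \{\boldsymbol{x} \in \mathbb{Z}^{n} : \sum_{i=1}^{n} x_i \equiv 0 \pmod 2\}$; $E_8 = D_8 \cup \left(\tfrac12 \boldsymbol{1}_8 + D_8\right) \subset \mathbb{R}^8$; $E_7$ is the sublattice of $E_8$ of all vectors orthogonal to $\boldsymbol{e}_7 + \boldsymbol{e}_8$; $E_6$ is the sublattice of $E_8$ of all vectors orthogonal to both $\boldsymbol{e}_7 + \boldsymbol{e}_8$ and $\boldsymbol{e}_6 + \boldsymbol{e}_8$. *)

(* Defs.v *)
From HB Require Import structures.
From mathcomp Require Import all_boot all_order all_algebra.
From mathcomp Require Import classical_sets reals.

Set Implicit Arguments.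
Unset Strict Implicit.
Unset Printing Implicit Defensive.

Import Order.TTheory GRing.Theory Num.Theory.

Local Open Scope classical_set_scope.
Local Open Scope ring_scope.

(* Vectors of R^m are row vectors, and coordinates are numbered from 0: the
   i-th coordinate x_i (1 <= i <= m) of the mathematical text is entry i - 1. *)

Definition dot (R : realType) (m : nat) (x y : 'rV[R]_m) : R :=
  \sum_(i < m) x 0 i * y 0 i.

Definition spanZ (R : realType) (m n : nat) (v : 'I_n -> 'rV[R]_m) :
    set 'rV[R]_m :=
  [set x | exists z : 'I_n -> int, x = \sum_(i < n) (z i)%:~R *: v i].

Definition spanR (R : realType) (m : nat) (L : set 'rV[R]_m) : set 'rV[R]_m :=
  [set x | exists (k : nat) (c : 'I_k -> R) (v : 'I_k -> 'rV[R]_m),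
     (forall i, L (v i)) /\ x = \sum_(i < k) c i *: v i].

(* The rows of B are an R-linearly independent Z-basis of L. *)
Definition lattice_of_rank (R : realType) (m n : nat) (L : set 'rV[R]_m) :
    Prop :=
  exists2 B : 'M[R]_(n, m), row_free B & L = spanZ (fun i => row i B).

Definition lattice (R : realType) (m : nat) (L : set 'rV[R]_m) : Prop :=
  exists n : nat, lattice_of_rank n L.

Definition dual (R : realType) (m : nat) (L : set 'rV[R]_m) : set 'rV[R]_m :=
  [set x | spanR L x /\ forall y, L y -> dot x y \is a Num.int].

(* ord_pred is the cyclic predecessor on 'I_m, so the entry of index 0 of
   rho c is the last entry of c. *)
Definition rho (R : realType) (m : nat) (c : 'rV[R]_m) : 'rV[R]_m :=
  \row_(i < m) c 0 (ord_pred i).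

Definition cyclic_lattice (R : realType) (m : nat) (L : set 'rV[R]_m) : Prop :=
  lattice L /\ @rho R m @` L = L.

Definition cyclic_lattice_of_rank (R : realType) (m n : nat)
    (L : set 'rV[R]_m) : Prop :=
  lattice_of_rank n L /\ cyclic_lattice L.

Definition simple_cyclic_of_rank (R : realType) (m n : nat)
    (L : set 'rV[R]_m) : Prop :=
  cyclic_lattice_of_rank n L /\
  exists2 a : 'rV[R]_m, L a & L = spanZ (fun i : 'I_n => iter i (@rho R m) a).

Definition simple_cyclic (R : realType) (m : nat) (L : set 'rV[R]_m) : Prop :=
  exists n : nat, simple_cyclic_of_rank n L.

Definition rootA (R : realType) (n : nat) : set 'rV[R]_n.+1 :=
  [set x | exists2 z : 'rV[int]_n.+1,
     x = map_mx intr z & \sum_(i < n.+1) z 0 i = 0].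

Definition rootD (R : realType) (n : nat) : set 'rV[R]_n :=
  [set x | exists2 z : 'rV[int]_n,
     x = map_mx intr z & (\sum_(i < n) z 0 i = 0 %[mod 2])%Z].

Arguments rootA R n : clear implicits.
Arguments rootD R n : clear implicits.

Definition rootE8 (R : realType) : set 'rV[R]_8 :=
  rootD R 8 `|` [set const_mx (1 / 2) + x | x in rootD R 8].

(* k is the index counted from 1 (1 <= k <= 8). *)
Definition e8 (R : realType) (k : nat) : 'rV[R]_8 := delta_mx 0 (inord k.-1).

Definition rootE7 (R : realType) : set 'rV[R]_8 :=
  [set x | rootE8 x /\ dot x (e8 R 7 + e8 R 8) = 0].

Definition rootE6 (R : realType) : set 'rV[R]_8 :=
  [set x | [/\ rootE8 x, dot x (e8 R 7 + e8 R 8) = 0 &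
                         dot x (e8 R 6 + e8 R 8) = 0]].

Arguments rootE8 R : clear implicits.
Arguments rootE7 R : clear implicits.
Arguments rootE6 R : clear implicits.

(* Main.v *)
Require Import Defs.
From HB Require Import structures.
From mathcomp Require Import all_boot all_order all_algebra.
From mathcomp Require Import classical_sets reals.
From mathcomp Require Import ring lra zify.

Set Implicit Arguments.
Unset Strict Implicit.
Unset Printing Implicit Defensive.

Import Order.TTheory GRing.Theory Num.Theory.

Local Open Scope classical_set_scope.
Local Open Scope ring_scope.

(** Every lattice here has a description by its coordinates and their sum, the
total: A_n is given by integral coordinates and total zero, D_n by integral
coordinates and even total; testing against the roots e i - e j and e i + e j
shows that the dual of A_n is given by integral differences of coordinates and
total zero, and the dual of D_n by integral differences and integral doubles
([dual_rootAE], [dual_rootDE]).  E_8 is the set of vectors of even total in the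
dual of D_8 ([rootE8E]).  All these conditions are symmetric in the
coordinates, so these lattices are stable under the rotation.  E_6 and E_7 are
not, as one rotation takes (-1, 1, 1, 1, 1, 1, 1, -1) / 2 out of E_7.

Ranks come from explicit bases: e (i+1) - e 0 for A_n, the projections of the
e i for its dual, and e 0 + e i for D_n; the lattices E_6, E_7 and E_8 consist
of a copy of D_5, D_6 or D_7 extended by one glue vector ([glue_lattice]).

The generators of the simple cyclic lattices are e 1 - e 0 for A_n, the
projection of e 0 for its dual, and e 0 + e 1 for D_n with n odd.  The case of
the dual of D_n with n odd follows formally: the rotation is an isometry, so
the basis dual to the rotations of one vector consists again of the rotations
of one vector ([dual_simple_cyclic]).

In even dimension the total and the alternating total are both
eigenfunctionals of the rotation, for the eigenvalues 1 and -1.  If L is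
spanned by the rotations of a, their values on an element of L are therefore
integer multiples of their values at a, with multipliers of the same parity.
If totals in L are even, as in D_n and E_8, this is contradicted by e 0 + e 1
and e 0 - e 1 ([not_simple_cyclic]).  In the dual of D_n with n even, totals
are integers, and expressing e 0 by rotations of a forces a to be integral,
so that its rotations do not span (1, ..., 1) / 2
([dual_rootD_not_simple_cyclic]). *)

(** * Integer spans and lattice bases *)

Definition subgroup (R : realType) (m : nat) (L : set 'rV[R]_m) : Prop :=
  L 0 /\ forall x y, L x -> L y -> L (x - y).

Section Span.
Variables (R : realType) (m : nat).
Implicit Types (L : set 'rV[R]_m) (x y : 'rV[R]_m).

Lemma subgroupN L x : subgroup L -> L x -> L (- x).
Proof. by move=> [L0 LB] Lx; rewrite -sub0r; apply: LB. Qed.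

Lemma subgroupD L x y : subgroup L -> L x -> L y -> L (x + y).
Proof.
by move=> sL Lx Ly; rewrite -[y]opprK; apply: sL.2 => //; apply: subgroupN.
Qed.

Lemma subgroup_sum L (I : finType) (P : pred I) (F : I -> 'rV[R]_m) :
  subgroup L -> (forall i, P i -> L (F i)) -> L (\sum_(i | P i) F i).
Proof.
move=> sL LF; elim/big_ind: _ => [|x y Lx Ly|//]; first exact: sL.1.
exact: subgroupD.
Qed.

Lemma subgroupZ L x (z : R) :
  subgroup L -> z \is a Num.int -> L x -> L (z *: x).
Proof.
move=> sL /intrP[k ->] Lx.
have nat_mul (n : nat) : L (n%:R *: x).
  elim: n => [|n IHn]; first by rewrite scale0r; exact: sL.1.
  by rewrite mulrS scalerDl scale1r; apply: subgroupD.
case: k => n; first exact: nat_mul.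
by rewrite NegzE mulrNz scaleNr; apply: subgroupN => //; apply: nat_mul.
Qed.

Lemma subgroup_spanZ n (v : 'I_n -> 'rV[R]_m) : subgroup (spanZ v).
Proof.
split=> [|x y [z ->] [t ->]].
  by exists (fun=> 0); rewrite big1 // => i _; rewrite scale0r.
exists (fun i => z i - t i); rewrite -sumrB; apply: eq_bigr => i _.
by rewrite -scalerBl intrB.
Qed.

Lemma spanZ_gen n (v : 'I_n -> 'rV[R]_m) i : spanZ v (v i).
Proof.
exists (fun j => (j == i)%:R).
rewrite (bigD1 i) //= eqxx scale1r big1 ?addr0 // => j /negPf->.
by rewrite scale0r.
Qed.

Lemma spanZ_sub n (v : 'I_n -> 'rV[R]_m) L :
  subgroup L -> (forall i, L (v i)) -> spanZ v `<=` L.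
Proof.
move=> sL Lv x [z ->]; apply: subgroup_sum => // i _.
by apply: subgroupZ => //; apply: intr_int.
Qed.

Lemma spanZ_int n (v : 'I_n -> 'rV[R]_m) (c : 'I_n -> R) :
  (forall i, c i \is a Num.int) -> spanZ v (\sum_i c i *: v i).
Proof.
move=> cint; apply: subgroup_sum => [|i _]; first exact: subgroup_spanZ.
by apply: subgroupZ (spanZ_gen v i) => //; apply: subgroup_spanZ.
Qed.

Lemma eq_spanZ n (v w : 'I_n -> 'rV[R]_m) : v =1 w -> spanZ v = spanZ w.
Proof.
move=> vw; apply/seteqP; split=> x [z ->]; exists z;
  by apply: eq_bigr => i _; rewrite vw.
Qed.

(** The form in which ranks are established: the two inclusions of L and the
span are replaced by membership of the basis and expansion of an element. *)
Lemma lattice_basis n (v : 'I_n -> 'rV[R]_m) L :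
    (forall c : 'I_n -> R, \sum_i c i *: v i = 0 -> forall i, c i = 0) ->
    subgroup L -> (forall i, L (v i)) -> L `<=` spanZ v ->
  lattice_of_rank n L.
Proof.
move=> vfree sL Lv Lspan.
have rowv i : row i (\matrix_j v j) = v i by rewrite rowK.
exists (\matrix_i v i).
  apply: inj_row_free => c; rewrite mulmx_sum_row => c0.
  apply/rowP=> i; rewrite [RHS]mxE; apply: vfree.
  by rewrite -[RHS]c0; apply: eq_bigr => j _; rewrite rowK.
apply/seteqP; split; rewrite (eq_spanZ rowv) //.
exact: spanZ_sub.
Qed.

End Span.

(** * The rotation *)

Definition total (R : realType) (m : nat) (x : 'rV[R]_m) : R :=
  \sum_i x 0 i.

Section Linear.
Variables (R : realType) (m : nat).

Lemma total_is_linear : linear_for *%R (@total R m).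
Proof.
move=> a x y; rewrite /total mulr_sumr -big_split.
by apply: eq_bigr => i _; rewrite !mxE.
Qed.
HB.instance Definition _ :=
  GRing.isLinear.Build R 'rV[R]_m R *%R (@total R m) total_is_linear.

Lemma rho_is_linear : linear (@rho R m).
Proof. by move=> a x y; apply/rowP=> i; rewrite !mxE. Qed.
HB.instance Definition _ :=
  GRing.isLinear.Build R 'rV[R]_m 'rV[R]_m *:%R (@rho R m) rho_is_linear.

Lemma total_rho (x : 'rV[R]_m) : total (rho x) = total x.
Proof.
rewrite /total [RHS](reindex_onto (@ord_pred m) (@ordS m)) /=; last first.
  by move=> i _; rewrite ordSK.
by apply: eq_big => [i|i _]; rewrite ?ord_predK ?eqxx ?mxE.
Qed.

Lemma total_iter_rho k (x : 'rV[R]_m) : total (iter k (@rho R m) x) = total x.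
Proof. by elim: k => //= k IHk; rewrite total_rho. Qed.

Lemma dot_rho (x y : 'rV[R]_m) : dot (rho x) (rho y) = dot x y.
Proof.
have dotE u v : dot u v = total (\row_i (u 0 i * v 0 i)).
  by apply: eq_bigr => i _; rewrite mxE.
by rewrite !dotE -[RHS]total_rho; congr total; apply/rowP=> i; rewrite !mxE.
Qed.

End Linear.

Lemma rowBE (R : realType) m (x y : 'rV[R]_m) i : (x - y) 0 i = x 0 i - y 0 i.
Proof. by rewrite !mxE. Qed.

Lemma rowZE (R : realType) m a (x : 'rV[R]_m) i : (a *: x) 0 i = a * x 0 i.
Proof. by rewrite mxE. Qed.

(** Reading the index modulo the dimension makes the rotation act as i |-> i.+1
without a boundary case. *)
Definition evec (R : realType) (m i : nat) : 'rV[R]_m.+1 :=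
  delta_mx 0 (inZp i).

Section Rotation.
Variables (R : realType) (m : nat).
Implicit Types (x y : 'rV[R]_m.+1) (i j k : nat).
Local Notation e := (evec R m).

Lemma rho_evec i : rho (e i) = e i.+1.
Proof.
apply/rowP=> j; rewrite !mxE !eqxx /=.
rewrite (can2_eq (@ord_predK _) (@ordSK _)).
congr (_ == _)%:R; apply: val_inj => /=.
by rewrite -addn1 modnDml addn1.
Qed.

Lemma evec_period i : e (i + m.+1) = e i.
Proof. by congr delta_mx; apply: val_inj; rewrite /= modnDr. Qed.

Lemma row_sum_evec x : x = \sum_(i < m.+1) x 0 i *: e i.
Proof.
by rewrite [LHS]row_sum_delta; apply: eq_bigr => i _; rewrite /evec valZpK.
Qed.

Lemma evecE (i j : 'I_m.+1) : e i 0 j = (i == j)%:R.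
Proof. by rewrite mxE eqxx valZpK eq_sym. Qed.

Lemma sum_mul_delta n (c : 'I_n -> R) (j : 'I_n) :
  \sum_i c i * (i == j)%:R = c j.
Proof.
rewrite (bigD1 j) //= eqxx mulr1 big1 ?addr0 // => i /negPf->.
by rewrite mulr0.
Qed.

Lemma total_const n (c : R) : total (const_mx c : 'rV[R]_n) = c * n%:R.
Proof.
rewrite /total; under eq_bigr do rewrite mxE.
by rewrite sumr_const card_ord mulr_natr.
Qed.

Lemma total_evec i : total (e i) = 1.
Proof.
rewrite /total (bigD1 (inZp i)) //= big1 => [|j /negPf ji].
  by rewrite mxE !eqxx addr0.
by rewrite mxE ji andbF.
Qed.

Lemma dot_evec x i : dot x (e i) = x 0 (inZp i).
Proof.
rewrite /dot (bigD1 (inZp i)) //= big1 => [|j /negPf ji].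
  by rewrite mxE !eqxx addr0 mulr1.
by rewrite mxE ji andbF mulr0.
Qed.

Lemma iter_rhoE k x : iter k (@rho R _) x = \sum_i x 0 i *: e (i + k).
Proof.
elim: k => [|k /= ->].
  by rewrite [LHS]row_sum_evec; apply: eq_bigr => i _; rewrite addn0.
rewrite linear_sum; apply: eq_bigr => i _.
by rewrite linearZ /= rho_evec addnS.
Qed.

Lemma iter_rho_evec k i : iter k (@rho R _) (e i) = e (i + k).
Proof. by elim: k => [|k /= ->]; rewrite ?addn0 // rho_evec addnS. Qed.

Lemma iter_rhoB k x y :
  iter k (@rho R _) (x - y) = iter k (@rho R _) x - iter k (@rho R _) y.
Proof. by elim: k => //= k ->; rewrite linearB. Qed.

Lemma iter_rhoD k x y :
  iter k (@rho R _) (x + y) = iter k (@rho R _) x + iter k (@rho R _) y.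
Proof. by elim: k => //= k ->; rewrite linearD. Qed.

Lemma iter_rho_period x : iter m.+1 (@rho R _) x = x.
Proof.
rewrite iter_rhoE [RHS]row_sum_evec.
by apply: eq_bigr => i _; rewrite evec_period.
Qed.

Lemma iter_rho_closed (L : set 'rV[R]_m.+1) k x :
  (forall y, L y -> L (rho y)) -> L x -> L (iter k (@rho R _) x).
Proof. by move=> Lrho Lx; elim: k => //= k; apply: Lrho. Qed.

(** Since rho has finite order, stability under rho gives stability under its
inverse. *)
Lemma rho_image (L : set 'rV[R]_m.+1) :
  (forall x, L x -> L (rho x)) -> @rho R _ @` L = L.
Proof.
move=> Lrho; apply/seteqP; split=> [_ [x Lx <-]|x Lx]; first exact: Lrho.
exists (iter m (@rho R _) x); last by rewrite -iterS iter_rho_period.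
exact: iter_rho_closed.
Qed.

Lemma cyclic_of_rank n (L : set 'rV[R]_m.+1) :
    lattice_of_rank n L -> (forall x, L x -> L (rho x)) ->
  cyclic_lattice_of_rank n L.
Proof.
by move=> latL Lrho; split=> //; split; [exists n | exact: rho_image].
Qed.

Lemma simple_cyclicP n (L : set 'rV[R]_m.+1) a :
    cyclic_lattice_of_rank n L -> subgroup L -> L a ->
    L `<=` spanZ (fun i : 'I_n => iter i (@rho R _) a) ->
  simple_cyclic_of_rank n L.
Proof.
move=> cL sL La Lspan; split=> //; exists a => //.
have [_ [_ rhoL]] := cL.
apply/seteqP; split=> //; apply: spanZ_sub => // i.
by apply: iter_rho_closed => // y Ly; rewrite -rhoL; exists y.
Qed.

End Rotation.

(** * Duals of full-rank lattices *)

Section Dual.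
Variable R : realType.

Lemma dotE m (x y : 'rV[R]_m) : dot x y = (x *m y^T) 0 0.
Proof. by rewrite mxE; apply: eq_bigr => i _; rewrite mxE. Qed.

Lemma spanZ_rows m n (B : 'M[R]_(n, m)) (x : 'rV[R]_m) :
  spanZ (fun i => row i B) x <->
  exists2 c : 'rV[R]_n, (forall i, c 0 i \is a Num.int) & x = c *m B.
Proof.
split=> [[z ->]|[c cint ->]]; last by rewrite mulmx_sum_row; apply: spanZ_int.
exists (\row_i (z i)%:~R) => [i|]; first by rewrite mxE intr_int.
by rewrite mulmx_sum_row; apply: eq_bigr => i _; rewrite mxE.
Qed.

(** The rows of the inverse transpose of a basis matrix form the dual basis. *)
Lemma dual_spanZ m (B B' : 'M[R]_m) :
  B *m B'^T = 1%:M ->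
  dual (spanZ (fun i => row i B)) = spanZ (fun i => row i B').
Proof.
move=> BB'; have B'B := mulmx1C BB'.
have BtB' : B^T *m B' = 1%:M by rewrite -[B']trmxK -trmx_mul B'B trmx1.
apply/seteqP; split=> [x [_ xint]|x /spanZ_rows[c cint ->]].
  apply/spanZ_rows; exists (x *m B^T); last by rewrite -mulmxA BtB' mulmx1.
  move=> i; rewrite (_ : _ 0 i = dot x (row i B)).
    exact/xint/(spanZ_gen (fun i => row i B)).
  by rewrite mxE; apply: eq_bigr => j _; rewrite !mxE.
split=> [|_ /spanZ_rows[d dint ->]].
  exists m, ((c *m B' *m B'^T) 0), (fun i => row i B); split=> [i|].
    exact: (spanZ_gen (fun i => row i B)).
  by rewrite -mulmx_sum_row -mulmxA B'B mulmx1.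
rewrite dotE trmx_mul mulmxA -(mulmxA c) (mulmx1C BtB') mulmx1 mxE.
by apply: rpred_sum => i _; rewrite mxE rpredM.
Qed.

Lemma dual_lattice_of_rank m (L : set 'rV[R]_m) :
  lattice_of_rank m L -> lattice_of_rank m (dual L).
Proof.
move=> [B Bfree ->]; rewrite row_free_unit in Bfree.
exists (invmx B)^T; last by apply: dual_spanZ; rewrite trmxK mulmxV.
by rewrite row_free_unit unitmx_tr unitmx_inv.
Qed.

Lemma iter_dot_rho m k (x y : 'rV[R]_m) :
  dot (iter k (@rho R m) x) (iter k (@rho R m) y) = dot x y.
Proof. by elim: k => //= k <-; rewrite dot_rho. Qed.

(** As rho is an isometry of period m.+1, the pairings of rho^i(a) with rho^j(b)
depend only on i - j modulo m.+1.  Hence if b is the member of the dual basis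
paired with a, its rotations are the other members. *)
Lemma dual_simple_cyclic m (L : set 'rV[R]_m.+1) :
    simple_cyclic_of_rank m.+1 L ->
  exists2 b, dual L b &
    dual L = spanZ (fun i : 'I_m.+1 => iter i (@rho R _) b).
Proof.
move=> [[[B Bfree LB] _] [a La La']].
pose C := \matrix_(i < m.+1) iter i (@rho R _) a.
have LC : L = spanZ (fun i => row i C).
  by rewrite La'; apply: eq_spanZ => i; rewrite rowK.
(* A basis of L consists of combinations of the rows of C. *)
have Cunit : C \in unitmx.
  rewrite -row_free_unit -row_leq_rank.
  have /eqP {1}<- := Bfree; apply: mxrankS.
  apply/row_subP=> i; have: spanZ (fun i => row i C) (row i B).
    by rewrite -LC LB; apply: (spanZ_gen (fun i => row i B)).
  by move=> /spanZ_rows[c _ ->]; apply: submxMl.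
pose b := row 0 (invmx C)^T.
have dot_ab (k : 'I_m.+1) : dot (iter k (@rho R _) a) b = (k == 0)%:R.
  have := congr1 (fun D : 'M_m.+1 => D k 0) (mulmxV Cunit).
  rewrite !mxE => <-; apply: eq_bigr => i _.
  by rewrite !mxE.
pose C' := \matrix_(j < m.+1) iter j (@rho R _) b.
have CC' : C *m C'^T = 1%:M.
  apply/matrixP=> i j; rewrite [RHS]mxE.
  transitivity (dot (iter i (@rho R _) a) (iter j (@rho R _) b)).
    by rewrite mxE; apply: eq_bigr => k _; rewrite !mxE.
  have [ji|ij] := leqP j i.
    have ik : (i - j < m.+1)%N by apply: leq_ltn_trans (leq_subr _ _) _.
    rewrite -{1}(subnKC ji) iterD iter_dot_rho (dot_ab (Ordinal ik)).
    by rewrite -!val_eqE /= subn_eq0 eqn_leq ji andbT.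
  (* For i < j, one more period on the left makes the exponents subtract. *)
  have jk : (i + m.+1 - j < m.+1)%N by have := ltn_ord j; lia.
  rewrite -[iter i _ a]iter_rho_period -iterD.
  rewrite (_ : (m.+1 + i = j + (i + m.+1 - j))%N); last first.
    by have := ltn_ord j; lia.
  rewrite iterD iter_dot_rho (dot_ab (Ordinal jk)) -!val_eqE /=.
  by congr (_%:R); have := ltn_ord j; lia.
have dualE : dual L = spanZ (fun j : 'I_m.+1 => iter j (@rho R _) b).
  by rewrite LC (dual_spanZ CC'); apply: eq_spanZ => j; rewrite rowK.
exists b => //; rewrite dualE.
exact: (spanZ_gen (fun j : 'I_m.+1 => iter j (@rho R _) b) 0).
Qed.

End Dual.

(** * Coordinate descriptions of the lattices *)

Section Descriptions.
Variable R : realType.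

Lemma int_rowP m (x : 'rV[R]_m) :
  (forall i, x 0 i \is a Num.int) <->
  exists z : 'rV[int]_m, x = map_mx intr z.
Proof.
split=> [xint|[z ->] i]; last by rewrite mxE intr_int.
have [z xz] := fin_all_exists (fun i => intrP (xint i)).
by exists (\row_i z i); apply/rowP=> i; rewrite !mxE xz.
Qed.

Lemma total_map_intr m (z : 'rV[int]_m) :
  total (map_mx intr z : 'rV[R]_m) = (\sum_i z 0 i)%:~R.
Proof. by rewrite rmorph_sum; apply: eq_bigr => i _; rewrite mxE. Qed.

Lemma intr_half (a : int) :
  (a%:~R / 2 : R) \is a Num.int <-> (a = 0 %[mod 2])%Z.
Proof.
split=> [/intrP[b ab]|a2].
  have -> : a = b * 2.
    by apply: (@intr_inj R); rewrite intrM -ab divfK // pnatr_eq0.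
  by rewrite modzMl mod0z.
apply/intrP; exists (a %/ 2)%Z.
rewrite mod0z in a2; have /dvdz_mod0P/divzK {1}<- := a2.
by rewrite intrM mulfK // pnatr_eq0.
Qed.

Lemma half_not_int : (1 / 2 : R) \isn't a Num.int.
Proof. by apply/negP => /(intr_half 1); rewrite mod0z. Qed.

Lemma rootAE n (x : 'rV[R]_n.+1) :
  rootA R n x <-> (forall i, x 0 i \is a Num.int) /\ total x = 0.
Proof.
split=> [[z -> z0]|[/int_rowP[z ->]]].
  by split; [apply/int_rowP; exists z | rewrite total_map_intr z0].
by rewrite total_map_intr => /eqP; rewrite intr_eq0 => /eqP z0; exists z.
Qed.

Lemma rootDE n (x : 'rV[R]_n) :
  rootD R n x <->
  (forall i, x 0 i \is a Num.int) /\ total x / 2 \is a Num.int.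
Proof.
split=> [[z -> /intr_half z0]|[/int_rowP[z ->]]].
  by split; [apply/int_rowP; exists z | rewrite total_map_intr].
by rewrite total_map_intr => /intr_half z0; exists z.
Qed.

Lemma subgroup_rootA n : subgroup (rootA R n).
Proof.
split=> [|x y /rootAE[xi x0] /rootAE[yi y0]]; apply/rootAE; split.
- by move=> i; rewrite mxE rpred0.
- exact: linear0.
- by move=> i; rewrite !mxE rpredB.
- by rewrite linearB /= x0 y0 subr0.
Qed.

Lemma subgroup_rootD n : subgroup (rootD R n).
Proof.
split=> [|x y /rootDE[xi x0] /rootDE[yi y0]]; apply/rootDE; split.
- by move=> i; rewrite mxE rpred0.
- by rewrite linear0 mul0r rpred0.
- by move=> i; rewrite !mxE rpredB.
- by rewrite linearB mulrBl rpredB.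
Qed.

Lemma rootA_evecB n i j : rootA R n (evec R n i - evec R n j).
Proof.
apply/rootAE; split=> [k|]; last by rewrite linearB /= !total_evec subrr.
by rewrite !mxE rpredB ?natr_int.
Qed.

Lemma rootD_evecD n i j : rootD R n.+1 (evec R n i + evec R n j).
Proof.
apply/rootDE; split=> [k|].
  by rewrite !mxE rpredD ?natr_int.
by rewrite linearD /= !total_evec divff ?rpred1 // (pnatr_eq0 R 2).
Qed.

Lemma rootD_evecB n i j : rootD R n.+1 (evec R n i - evec R n j).
Proof.
apply/rootDE; split=> [k|].
  by rewrite !mxE rpredB ?natr_int.
by rewrite linearB /= !total_evec subrr mul0r rpred0.
Qed.

Lemma dot_linearr m (x : 'rV[R]_m) : linear_for *%R (dot x).
Proof.
move=> a y z; rewrite /dot mulr_sumr -big_split.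
by apply: eq_bigr => i _; rewrite !mxE mulrDr mulrCA.
Qed.
HB.instance Definition _ m (x : 'rV[R]_m) :=
  GRing.isLinear.Build R 'rV[R]_m R *%R (dot x) (dot_linearr x).

(** Pairing with the roots e i - e j forces integral differences of
coordinates; conversely, on vectors of total zero a common shift of all
coordinates does not change the pairing. *)
Lemma dual_rootAE n (x : 'rV[R]_n.+1) :
  dual (rootA R n) x <->
  (forall i j, x 0 i - x 0 j \is a Num.int) /\ total x = 0.
Proof.
split=> [[[k [c [v [Lv xE]]]] xint]|[xint x0]].
  split=> [i j|].
    have := xint _ (rootA_evecB n i j).
    by rewrite linearB /= !dot_evec !valZpK.
  rewrite xE linear_sum big1 // => i _; rewrite linearZ /=.
  by have /rootAE[_ ->] := Lv i; rewrite mulr0.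
split=> [|y /rootAE[yint y0]].
  exists n.+1, (x 0), (fun i : 'I_n.+1 => evec R n i - evec R n 0).
  split=> [i|].
    exact: rootA_evecB.
  under eq_bigr do rewrite scalerBr.
  by rewrite sumrB -row_sum_evec -scaler_suml -/(total x) x0 scale0r subr0.
have -> : dot x y = \sum_i (x 0 i - x 0 0) * y 0 i.
  under [RHS]eq_bigr do rewrite mulrBl.
  by rewrite sumrB -mulr_sumr -/(total y) y0 mulr0 subr0.
by apply: rpred_sum => i _; rewrite rpredM.
Qed.

(** The vectors 2 e i lie in D_n, so D_n spans the whole space. *)
Lemma spanR_rootD n (L : set 'rV[R]_n.+1) x :
  rootD R n.+1 `<=` L -> spanR L x.
Proof.
move=> DL; exists n.+1, (fun i => x 0 i / 2).
exists (fun i : 'I_n.+1 => evec R n i + evec R n i); split=> [i|].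
  exact/DL/rootD_evecD.
rewrite [LHS]row_sum_evec; apply: eq_bigr => i _.
by rewrite scalerDr -scalerDl -splitr.
Qed.

Lemma dual_rootDE n (x : 'rV[R]_n.+1) :
  dual (rootD R n.+1) x <->
  (forall i j, x 0 i - x 0 j \is a Num.int) /\
  (forall i, x 0 i + x 0 i \is a Num.int).
Proof.
split=> [[_ xint]|[xint x2]].
  split=> [i j|i].
    have := xint _ (rootD_evecB n i j).
    by rewrite linearB /= !dot_evec !valZpK.
  by have := xint _ (rootD_evecD n i i); rewrite linearD /= !dot_evec !valZpK.
split=> [|y /rootDE[yint y0]]; first exact: spanR_rootD.
have -> : dot x y =
    \sum_i (x 0 i - x 0 0) * y 0 i + (x 0 0 + x 0 0) * (total y / 2).
  under [X in _ = X + _]eq_bigr do rewrite mulrBl.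
  rewrite sumrB -mulr_sumr -/(total y) -/(dot x y).
  by field.
by apply: rpredD; [apply: rpred_sum => i _|]; rewrite rpredM.
Qed.

End Descriptions.

(** * The lattices A_n and their duals *)

Section RootA.
Variables (R : realType) (n : nat).
Local Notation e := (evec R n).

Lemma rootA_rho x : rootA R n x -> rootA R n (rho x).
Proof.
move=> /rootAE[xi x0]; apply/rootAE.
by split=> [i|]; rewrite ?total_rho // mxE.
Qed.

Lemma dual_rootA_rho x : dual (rootA R n) x -> dual (rootA R n) (rho x).
Proof.
move=> /dual_rootAE[xi x0]; apply/dual_rootAE.
by split=> [i j|]; rewrite ?total_rho // !mxE.
Qed.

Lemma rootA_expand (x : 'rV[R]_n.+1) :
  total x = 0 -> x = \sum_(i < n) x 0 (lift ord0 i) *: (e i.+1 - e 0).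
Proof.
rewrite /total big_ord_recl => /eqP; rewrite addr_eq0 => /eqP x0.
under eq_bigr do rewrite scalerBr.
rewrite sumrB -scaler_suml {1}(row_sum_evec x) big_ord_recl x0 scaleNr addrC.
by congr (_ - _).
Qed.

Lemma rootA_lattice : lattice_of_rank n (rootA R n).
Proof.
apply: (lattice_basis (v := fun i : 'I_n => e i.+1 - e 0)).
- move=> c c0 j; have := congr1 (fun x : 'rV_n.+1 => x 0 (lift ord0 j)) c0.
  rewrite summxE mxE => coord0.
  rewrite -[RHS]coord0 -[LHS](sum_mul_delta c j); apply: eq_bigr => i _.
  rewrite rowZE rowBE (evecE R (lift ord0 i)) (evecE R ord0) (inj_eq lift_inj).
  by rewrite (negPf (neq_lift _ _)) subr0.
- exact: subgroup_rootA.
- by move=> i; apply: rootA_evecB.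
- by move=> x /rootAE[xint x0]; rewrite (rootA_expand x0); apply: spanZ_int.
Qed.

Lemma rootA_simple_cyclic : simple_cyclic_of_rank n (rootA R n).
Proof.
apply: (simple_cyclicP (a := e 1 - e 0)) => //.
- exact: cyclic_of_rank rootA_lattice rootA_rho.
- exact: subgroup_rootA.
- exact: rootA_evecB.
set S := spanZ _; have sS : subgroup S by apply: subgroup_spanZ.
have Se k : (k <= n)%N -> S (e k - e 0).
  elim: k => [|k IHk] kn; first by rewrite subrr; apply: sS.1.
  rewrite -(subrKA (e k)); apply: subgroupD (IHk (ltnW kn)) => //.
  have := spanZ_gen (fun i : 'I_n => iter i (@rho R _) (e 1 - e 0))
    (Ordinal kn).
  by rewrite iter_rhoB !iter_rho_evec add1n add0n.
move=> x /rootAE[xint x0]; rewrite (rootA_expand x0).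
apply: subgroup_sum => // i _; apply: subgroupZ => //.
exact: Se.
Qed.

(** The projection of e i to the hyperplane of total zero. *)
Definition proj_evec i : 'rV[R]_n.+1 := e i - const_mx n.+1%:R^-1.
Local Notation p := proj_evec.

Lemma iter_rho_proj_evec k : iter k (@rho R _) (p 0) = p k.
Proof.
elim: k => //= k ->; rewrite linearB /= rho_evec; congr (_ - _).
by apply/rowP=> i; rewrite !mxE.
Qed.

Lemma dual_rootA_proj_evec i : dual (rootA R n) (p i).
Proof.
apply/dual_rootAE; split=> [j k|].
  rewrite !mxE opprB addrA subrK.
  by rewrite rpredB ?natr_int.
by rewrite linearB /= total_evec total_const mulVf ?subrr // pnatr_eq0.
Qed.

(** Since the n + 1 vectors p i sum to zero, the last one is dropped, which
replaces each coefficient by its difference with the last. *)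
Lemma dual_rootA_expand (x : 'rV[R]_n.+1) :
  total x = 0 ->
  x = \sum_(i < n) (x 0 (widen_ord (leqnSn n) i) - x 0 ord_max) *: p i.
Proof.
move=> x0.
transitivity (\sum_(i < n.+1) (x 0 i - x 0 ord_max) *: p i); last first.
  by rewrite big_ord_recr /= subrr scale0r addr0.
apply/rowP=> j; rewrite summxE.
under eq_bigr => i _ do rewrite rowZE rowBE evecE mxE mulrBr.
rewrite sumrB (sum_mul_delta (fun i => x 0 i - x 0 ord_max)) -mulr_suml.
rewrite sumrB -/(total x) x0 sumr_const card_ord sub0r mulNr opprK.
by rewrite -[x 0 ord_max *+ _]mulr_natr mulfK ?pnatr_eq0 // subrK.
Qed.

Lemma dual_rootA_free (c : 'I_n -> R) :
  \sum_i c i *: p i = 0 -> forall i, c i = 0.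
Proof.
move=> c0.
have coord (j : 'I_n.+1) :
    \sum_(i < n) c i * ((i : nat) == j)%:R = (\sum_i c i) / n.+1%:R.
  have := congr1 (fun x : 'rV_n.+1 => x 0 j) c0; rewrite summxE mxE => /eqP.
  under eq_bigr => i _ do
    rewrite rowZE rowBE (evecE R (widen_ord (leqnSn n) i)) mxE mulrBr.
  by rewrite sumrB -mulr_suml subr_eq0 => /eqP.
have sum0 : (\sum_i c i) / n.+1%:R = 0.
  rewrite -(coord ord_max) big1 // => i _.
  by rewrite (ltn_eqF (ltn_ord i)) mulr0.
by move=> i; rewrite -(sum_mul_delta c i) (coord (widen_ord (leqnSn n) i)).
Qed.

Lemma subgroup_dual_rootA : subgroup (dual (rootA R n)).
Proof.
split=> [|x y /dual_rootAE[xi x0] /dual_rootAE[yi y0]];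
  apply/dual_rootAE; split.
- by move=> i j; rewrite !mxE subrr rpred0.
- exact: linear0.
- by move=> i j; rewrite !mxE opprD addrACA -opprD rpredB.
- by rewrite linearB /= x0 y0 subr0.
Qed.

Lemma dual_rootA_span : dual (rootA R n) `<=` spanZ (fun i : 'I_n => p i).
Proof.
move=> x /dual_rootAE[xint x0]; rewrite (dual_rootA_expand x0).
exact: spanZ_int.
Qed.

Lemma dual_rootA_simple_cyclic :
  simple_cyclic_of_rank n (dual (rootA R n)).
Proof.
apply: (simple_cyclicP (a := p 0)).
- apply: cyclic_of_rank dual_rootA_rho.
  apply: (lattice_basis (v := fun i : 'I_n => p i)).
  + exact: dual_rootA_free.
  + exact: subgroup_dual_rootA.
  + by move=> i; apply: dual_rootA_proj_evec.
  + exact: dual_rootA_span.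
- exact: subgroup_dual_rootA.
- exact: dual_rootA_proj_evec.
rewrite (eq_spanZ (fun i : 'I_n => iter_rho_proj_evec i)).
exact: dual_rootA_span.
Qed.

End RootA.

(** * The lattices D_n and their duals *)

Section RootD.
Variables (R : realType) (m : nat).
Local Notation e := (evec R m).

Lemma rootD_rho n (x : 'rV[R]_n) : rootD R n x -> rootD R n (rho x).
Proof.
move=> /rootDE[xi x0]; apply/rootDE.
by split=> [i|]; rewrite ?total_rho // mxE.
Qed.

Lemma dual_rootD_rho x : dual (rootD R m.+1) x -> dual (rootD R m.+1) (rho x).
Proof.
move=> /dual_rootDE[xi x0]; apply/dual_rootDE.
by split=> [i j|i]; rewrite !mxE.
Qed.

Lemma subgroup_dual_rootD : subgroup (dual (rootD R m.+1)).
Proof.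
split=> [|x y /dual_rootDE[xi x2] /dual_rootDE[yi y2]];
  apply/dual_rootDE; split.
- by move=> i j; rewrite !mxE subrr rpred0.
- by move=> i; rewrite !mxE addr0 rpred0.
- by move=> i j; rewrite !mxE opprD addrACA -opprD rpredB.
- by move=> i; rewrite !mxE addrACA -opprD rpredB.
Qed.

(** The vectors e 0 + e i, with i = 0 allowed, form a basis: the coefficients
other than that of 2 e 0 are coordinates of x, and the coefficients add up to
half of the total of x. *)
Lemma rootD_expand (x : 'rV[R]_m.+1) :
  x = \sum_i (x 0 i - (total x / 2) *+ (i == 0)) *: (e 0 + e i).
Proof.
under eq_bigr do rewrite scalerBl [X in X - _]scalerDr.
rewrite sumrB big_split /= -scaler_suml -row_sum_evec -/(total x).
rewrite (bigD1 0) //= [X in _ - (_ + X)]big1 => [|i /negPf->]; last first.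
  by rewrite mulr0n scale0r.
by rewrite mulr1n addr0 scalerDr -scalerDl -splitr addrAC subrr add0r.
Qed.

Lemma rootD_free k (lekm : (k <= m.+1)%N) (c : 'I_k -> R) :
  \sum_i c i *: (e 0 + e i) = 0 -> forall i, c i = 0.
Proof.
move=> c0; have sum_c0 : \sum_i c i = 0.
  have := congr1 (@total R _) c0; rewrite linear_sum linear0 /=.
  under eq_bigr => i _ do rewrite linearZ /= linearD /= !total_evec.
  rewrite -mulr_suml => /eqP; rewrite mulf_eq0 (pnatr_eq0 R 2) orbF.
  by move/eqP.
move=> j; have := congr1 (fun x : 'rV_m.+1 => x 0 (widen_ord lekm j)) c0.
under eq_bigr do rewrite scalerDr.
rewrite big_split /= -scaler_suml sum_c0 scale0r add0r summxE mxE => coord0.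
rewrite -[RHS]coord0 -[LHS](sum_mul_delta c j); apply: eq_bigr => i _.
by rewrite rowZE (evecE R (widen_ord lekm i)).
Qed.

Lemma rootD_lattice : lattice_of_rank m.+1 (rootD R m.+1).
Proof.
apply: (lattice_basis (v := fun i : 'I_m.+1 => e 0 + e i)).
- exact: rootD_free.
- exact: subgroup_rootD.
- by move=> i; apply: rootD_evecD.
move=> x /rootDE[xint x2]; rewrite (rootD_expand x); apply: spanZ_int => i.
by rewrite rpredB ?rpredMn.
Qed.

Lemma rootD_cyclic : cyclic_lattice_of_rank m.+1 (rootD R m.+1).
Proof. exact: cyclic_of_rank rootD_lattice (@rootD_rho _). Qed.

Lemma dual_rootD_cyclic : cyclic_lattice_of_rank m.+1 (dual (rootD R m.+1)).
Proof.
exact: cyclic_of_rank (dual_lattice_of_rank rootD_lattice) dual_rootD_rho.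
Qed.

(** Telescoping the shifts e i + e i.+1 of the generator yields
e 0 - (-1)^k e k for every k.  As indices are read modulo the odd dimension,
the parity of k can be chosen freely, whence e 0 + e i for every i. *)
Lemma rootD_simple_cyclic :
  odd m.+1 -> simple_cyclic_of_rank m.+1 (rootD R m.+1).
Proof.
move=> modd; apply: (simple_cyclicP (a := e 0 + e 1)).
- exact: rootD_cyclic.
- exact: subgroup_rootD.
- exact: rootD_evecD.
set S := spanZ _; have sS : subgroup S by apply: subgroup_spanZ.
have Sshift k : S (e k + e k.+1).
  have ltk : (k %% m.+1 < m.+1)%N by rewrite ltn_mod.
  have := spanZ_gen (fun i : 'I_m.+1 => iter i (@rho R _) (e 0 + e 1))
    (Ordinal ltk).
  rewrite iter_rhoD !iter_rho_evec add0n add1n /=.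
  have inZp_mod i : e (i %% m.+1) = e i.
    by congr delta_mx; apply: val_inj; rewrite /= modn_mod.
  have inZp_modS i : e (i %% m.+1).+1 = e i.+1.
    by rewrite -!rho_evec inZp_mod.
  by rewrite inZp_mod inZp_modS.
have Salt k : S (e 0 - (-1) ^+ k *: e k).
  elim: k => [|k IHk]; first by rewrite scale1r subrr; apply: sS.1.
  have -> : e 0 - (-1) ^+ k.+1 *: e k.+1 =
      (e 0 - (-1) ^+ k *: e k) + (-1) ^+ k *: (e k + e k.+1).
    by rewrite exprS mulN1r scaleNr opprK scalerDr addrA subrK.
  apply: subgroupD => //; apply: subgroupZ => //.
  by rewrite rpredX // rpredN rpred1.
have Sodd k : odd k -> S (e 0 + e k).
  by move=> kodd; have := Salt k; rewrite -signr_odd kodd scaleN1r opprK.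
have Sgen k : S (e 0 + e k).
  have [/Sodd//|keven] := boolP (odd k).
  by rewrite -(evec_period R m k); apply: Sodd; rewrite oddD modd (negPf keven).
move=> x /rootDE[xint x2]; rewrite (rootD_expand x).
apply: subgroup_sum => // i _; apply: subgroupZ => //.
by rewrite rpredB ?rpredMn.
Qed.

End RootD.

(** * Obstructions in even dimension *)

Section EvenDimension.
Variables (R : realType) (m : nat).
Local Notation e := (evec R m).

Definition alt_total (x : 'rV[R]_m.+1) : R :=
  \sum_(i < m.+1) (-1) ^+ i * x 0 i.

Lemma alt_total_is_linear : linear_for *%R alt_total.
Proof.
move=> a x y; rewrite /alt_total mulr_sumr -big_split.
by apply: eq_bigr => i _; rewrite !mxE mulrDr mulrCA.
Qed.
HB.instance Definition _ :=
  GRing.isLinear.Build R 'rV[R]_m.+1 R *%R alt_total alt_total_is_linear.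

Lemma alt_total_evec (i : 'I_m.+1) : alt_total (e i) = (-1) ^+ i.
Proof.
rewrite -[RHS](sum_mul_delta (fun j : 'I_m.+1 => (-1) ^+ j) i).
by apply: eq_bigr => j _; rewrite evecE eq_sym.
Qed.

Lemma alt_total_iter_rho k x :
  ~~ odd m.+1 -> alt_total (iter k (@rho R _) x) = (-1) ^+ k * alt_total x.
Proof.
move=> meven; elim: k => [|k IHk]; first by rewrite mul1r.
rewrite iterS exprS -mulrA -{}IHk mulN1r.
move: (iter k _ x) => y; rewrite /alt_total -sumrN.
rewrite [RHS](reindex_onto (@ord_pred _) (@ordS _)) /=; last first.
  by move=> i _; rewrite ordSK.
apply: eq_big => [i|i _]; first by rewrite ord_predK eqxx.
rewrite mxE -mulNr; congr (_ * _).
rewrite -(signr_odd _ i) -(signr_odd _ (_ %% _)) -signrN.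
congr (_ ^+ nat_of_bool _).
rewrite odd_mod ?(negPf meven) // addnS oddD.
by move: meven => /= /negPn->; rewrite addbT negbK.
Qed.

(** For x = sum of z_i rho^i(a), total x is (sum z_i) total a and alt_total x
is (sum (-1)^i z_i) alt_total a, where the two integer factors have the same
parity.  If total x = 2 and total a is even, the first factor is odd, so the
second does not vanish; hence alt_total a = 0. *)
Lemma simple_cyclic_alt_total n (L : set 'rV[R]_m.+1) x y :
    ~~ odd m.+1 -> simple_cyclic_of_rank n L ->
    (forall z, L z -> total z / 2 \is a Num.int) ->
    L x -> total x = 2 -> alt_total x = 0 -> L y ->
  alt_total y = 0.
Proof.
move=> meven [_ [a La Lspan]] Leven Lx tx ax Ly.
have [t at2] := intrP (Leven _ La).
have spanE w : L w -> exists z : 'I_n -> int,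
    total w = (\sum_i z i)%:~R * total a /\
    alt_total w = (\sum_(i < n) (-1) ^+ i * z i)%:~R * alt_total a.
  rewrite Lspan => -[z ->]; exists z.
  split; rewrite linear_sum rmorph_sum mulr_suml.
    by apply: eq_bigr => i _; rewrite linearZ /= total_iter_rho.
  apply: eq_bigr => i _; rewrite linearZ /= alt_total_iter_rho //.
  by rewrite rmorphM rmorphXn rmorphN1 mulrCA mulrA.
suff a0 : alt_total a = 0.
  by have [z [_ ->]] := spanE _ Ly; rewrite a0 mulr0.
have [z [tz az]] := spanE _ Lx.
have ztotal : (\sum_i z i) * t = 1.
  apply: (@intr_inj R); rewrite rmorphM /= -at2 mulrA -tz tx.
  by rewrite divff // (pnatr_eq0 R 2).
have [w altE] : exists w, \sum_(i < n) (-1) ^+ i * z i = \sum_i z i - 2 * w.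
  exists (\sum_(i < n | odd i) z i).
  rewrite mulr_sumr (big_mkcond (fun i : 'I_n => odd i)) -sumrB /=.
  apply: eq_bigr => i _; rewrite -signr_odd.
  by case: (odd i); rewrite ?mul1r ?subr0 // mulN1r; ring.
move: az; rewrite ax => /esym/eqP; rewrite mulf_eq0 intr_eq0.
move=> /orP[/eqP|/eqP//].
(* Otherwise the sum of the z i is even, but it divides 1. *)
by rewrite altE; nia.
Qed.

End EvenDimension.

Section NotSimple.
Variables (R : realType) (m : nat).
Hypotheses (m_gt0 : (0 < m)%N) (meven : ~~ odd m.+1).
Local Notation e := (evec R m).

(** The vectors e 0 + e 1 and e 0 - e 1 have totals 2 and 0, and alternating
totals 0 and 2. *)
Lemma not_simple_cyclic (L : set 'rV[R]_m.+1) :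
    rootD R m.+1 `<=` L ->
    (forall z, L z -> total z / 2 \is a Num.int) ->
  ~ simple_cyclic L.
Proof.
move=> DL Leven [n Lsimple].
have alt_e1 : alt_total (e 1) = -1.
  by rewrite (alt_total_evec R (Ordinal (m_gt0 : (1 < m.+1)%N))).
have alt_e0 : alt_total (e 0) = 1 by rewrite (alt_total_evec R 0).
have := simple_cyclic_alt_total (x := e 0 + e 1) (y := e 0 - e 1)
  meven Lsimple Leven.
rewrite !linearD linearN /= !total_evec alt_e0 alt_e1 subrr opprK.
move=> /(_ (DL _ (rootD_evecD _ _ _ _)) erefl erefl).
by move=> /(_ (DL _ (rootD_evecB _ _ _ _)))/eqP; rewrite (pnatr_eq0 R 2).
Qed.

(** An even number of coordinates, congruent modulo 1 and with integral doubles,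
add up to an integer. *)
Lemma dual_rootD_total_int x :
  dual (rootD R m.+1) x -> total x \is a Num.int.
Proof.
move=> /dual_rootDE[xint x2].
have -> : total x = \sum_i (x 0 i - x 0 0) + (x 0 0 + x 0 0) *+ m.+1./2.
  rewrite sumrB sumr_const card_ord -[LHS](subrK (x 0 0 *+ m.+1)).
  congr (_ + _); rewrite -mulr2n -mulrnA mul2n.
  by congr (_ *+ _); rewrite -[LHS]odd_double_half (negPf meven).
by rewrite rpredD ?rpredMn // rpred_sum.
Qed.

(** Writing e 0 as the sum of z_i rho^i(a), the integer N = sum of z_i satisfies
N total a = 1, so N = 1 or -1.  All coordinates of all rho^i(a) are congruent to
a_0 modulo 1, hence N a_0 is an integer, and so is a_0: the span of the
rotations of a misses the vector with all coordinates 1/2. *)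
Lemma dual_rootD_not_simple_cyclic : ~ simple_cyclic (dual (rootD R m.+1)).
Proof.
move=> [n [_ [a Da Dspan]]].
have /dual_rootDE[aint _] := Da.
have rho_a (i j : nat) :
    exists k, iter i (@rho R _) a 0 (inZp j) = a 0 k.
  elim: i j => [|i IHi] j; first by exists (inZp j).
  rewrite iterS mxE -[ord_pred _]valZpK; exact: IHi.
have De0 : dual (rootD R m.+1) (e 0).
  by apply/dual_rootDE; split=> [i j|i]; rewrite !mxE ?rpredB ?rpredD ?natr_int.
have Dh : dual (rootD R m.+1) (const_mx (1 / 2)).
  apply/dual_rootDE; split=> [i j|i]; rewrite !mxE.
    by rewrite subrr rpred0.
  by rewrite -splitr rpred1.
have /intrP[t at1] := dual_rootD_total_int Da.
have a0int : a 0 0 \is a Num.int.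
  have := De0; rewrite Dspan => -[z e0E].
  have zt : (\sum_i (z i)%:~R) * total a = 1.
    have totalE := congr1 (@total R _) e0E.
    rewrite total_evec linear_sum in totalE; rewrite [RHS]totalE mulr_suml.
    by apply: eq_bigr => i _; rewrite linearZ /= total_iter_rho.
  have za0 : (\sum_i (z i)%:~R) * a 0 0 \is a Num.int.
    have -> : (\sum_i (z i)%:~R) * a 0 0 = e 0 0 0 -
        \sum_i (z i)%:~R * (iter i (@rho R _) a 0 0 - a 0 0).
      rewrite [in RHS]e0E summxE mulr_suml -sumrB; apply: eq_bigr => i _.
      by rewrite rowZE mulrBr subKr.
    apply: rpredB; first by rewrite mxE natr_int.
    apply: rpred_sum => i _; rewrite rpredM ?intr_int //.
    by have [k] := rho_a i 0; rewrite (valZpK 0) => ->.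
  by rewrite -[a 0 0]mul1r -zt mulrAC rpredM // at1 intr_int.
have := Dh; rewrite Dspan => -[z /(congr1 (fun x : 'rV_m.+1 => x 0 0))].
rewrite mxE summxE => hE; move/negP: (half_not_int R); apply; rewrite hE.
apply: rpred_sum => i _; rewrite rowZE rpredM ?intr_int //.
have [k] := rho_a i 0; rewrite (valZpK 0) => ->.
by rewrite -[a 0 k](subrK (a 0 0)) rpredD.
Qed.

End NotSimple.

(** * The lattices E_6, E_7 and E_8 *)

Section RootE.
Variable R : realType.

(** The last coordinate of an element determines the multiple of g to be
removed; the remainder lies in the copy of D_k on the first k coordinates. *)
Lemma glue_lattice m k (g : 'rV[R]_m.+1) (L : set 'rV[R]_m.+1) :
    (0 < k <= m)%N -> g 0 ord_max != 0 ->
    subgroup L -> L g ->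
    (forall i : 'I_k, L (evec R m 0 + evec R m i)) ->
    (forall x, L x -> let c := x 0 ord_max / g 0 ord_max in
       [/\ c \is a Num.int, rootD R m.+1 (x - c *: g) &
           forall j : 'I_m.+1, (k <= j)%N -> (x - c *: g) 0 j = 0]) ->
  lattice_of_rank k.+1 L.
Proof.
move=> /andP[k_gt0 lekm] g0 sL Lg LD Lglue.
have lekm1 : (k <= m.+1)%N by apply: leq_trans lekm _.
pose v (i : 'I_k.+1) :=
  if (i < k)%N then evec R m 0 + evec R m i else g.
have sumvE (c : 'I_k.+1 -> R) : \sum_i c i *: v i =
    \sum_(i < k) c (widen_ord (leqnSn k) i) *: (evec R m 0 + evec R m i) +
    c ord_max *: g.
  rewrite big_ord_recr /= /v ltnn; congr (_ + _).
  by apply: eq_bigr => i _; rewrite /= ltn_ord.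
apply: (lattice_basis (v := v)) => //.
- move=> c; rewrite sumvE => c0.
  have cmax : c ord_max = 0.
    have := congr1 (fun x : 'rV_m.+1 => x 0 ord_max) c0.
    rewrite mxE rowZE summxE big1 => [|i _].
      by rewrite add0r mxE => /eqP; rewrite mulf_eq0 (negPf g0) orbF => /eqP.
    have i_lt_m := leq_trans (ltn_ord i) lekm.
    rewrite rowZE mxE (evecE R 0) (evecE R (widen_ord lekm1 i)) -!val_eqE /=.
    by rewrite !ltn_eqF ?addr0 ?mulr0 // (leq_trans k_gt0).
  rewrite cmax scale0r addr0 in c0.
  have crest := rootD_free lekm1 c0.
  move=> i; have [ltik|] := ltnP i k.
    by rewrite -(crest (Ordinal ltik)); congr c; apply: val_inj.
  move=> leki; rewrite -cmax; congr c; apply: val_inj => /=.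
  by apply/eqP; rewrite eqn_leq leki -ltnS ltn_ord.
- by move=> i; rewrite /v; case: ltnP => // ltik; apply: (LD (Ordinal ltik)).
move=> x Lx; have [] := Lglue x Lx.
set c := x 0 ord_max / _; set y := x - c *: g => cint Dy y0.
have -> : x = y + c *: g by rewrite subrK.
have sS : subgroup (spanZ v) by apply: subgroup_spanZ.
apply: subgroupD => //; last first.
  by apply: subgroupZ => //; have := spanZ_gen v ord_max; rewrite {2}/v ltnn.
have /rootDE[yint y2] := Dy.
rewrite (rootD_expand y) (bigID (fun i : 'I_m.+1 => (i < k)%N)) /=.
rewrite [X in _ + X]big1 ?addr0 => [|i]; last first.
  rewrite -leqNgt => leki; rewrite y0 // -val_eqE /=.
  rewrite gtn_eqF ?(leq_trans k_gt0) //.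
  by rewrite mulr0n subr0 scale0r.
apply: subgroup_sum => // i ltik; apply: subgroupZ => //.
  by rewrite rpredB ?rpredMn.
have ltik1 : (i < k.+1)%N by apply: leq_trans ltik _.
by have := spanZ_gen v (Ordinal ltik1); rewrite {2}/v /= ltik.
Qed.

Lemma half_int_cases (a : R) :
  a + a \is a Num.int -> a \is a Num.int \/ a - 1 / 2 \is a Num.int.
Proof.
move=> /intrP[k a2]; have aE : a = k%:~R / 2 by rewrite -a2; field.
have [r0|r1] : (k %% 2 = 0 \/ k %% 2 = 1)%Z by lia.
  by left; rewrite aE; apply/intr_half; rewrite r0 mod0z.
right; rewrite aE -mulrBl -(intrB R k 1); apply/intr_half.
by rewrite mod0z; lia.
Qed.

Local Notation e := (evec R 7).
Local Notation h := (const_mx (1 / 2) : 'rV[R]_8).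

Lemma total_half : total h / 2 = 2.
Proof. by rewrite total_const; field. Qed.

(** The dual of D_8 is the union of Z^8 and its translate by (1, ..., 1) / 2;
even total selects D_8 and its translate. *)
Lemma rootE8E x :
  rootE8 R x <-> dual (rootD R 8) x /\ total x / 2 \is a Num.int.
Proof.
split=> [[/rootDE[xint x2]|[d /rootDE[dint d2] <-]]|].
- split=> //; apply/dual_rootDE.
  by split=> [i j|i]; rewrite ?rpredB ?rpredD.
- split; last by rewrite linearD mulrDl total_half rpredD ?natr_int.
  apply/dual_rootDE; split=> [i j|i]; rewrite !mxE.
    by rewrite opprD addrACA subrr add0r rpredB.
  by rewrite addrACA -splitr rpredD ?rpred1 ?rpredD.
move=> [/dual_rootDE[xint x2] xt].
have [x0|x0] := half_int_cases (x2 0).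
  left; apply/rootDE; split=> // i.
  by rewrite -(subrK (x 0 0) (x 0 i)) rpredD.
right; exists (x - h); last by rewrite addrC subrK.
apply/rootDE; split=> [i|]; last first.
  by rewrite linearB mulrBl total_half rpredB ?natr_int.
by rewrite !mxE -(subrK (x 0 0) (x 0 i)) -addrA rpredD.
Qed.

Lemma rootD_sub_rootE8 : rootD R 8 `<=` rootE8 R.
Proof. by move=> x Dx; left. Qed.

Lemma rootE8_half : rootE8 R h.
Proof.
right; exists 0; last by rewrite addr0.
exact: (subgroup_rootD R 8).1.
Qed.

Lemma subgroup_rootE8 : subgroup (rootE8 R).
Proof.
have [D0 DB] := subgroup_dual_rootD R 7.
split=> [|x y /rootE8E[Dx tx] /rootE8E[Dy ty]]; apply/rootE8E; split.
- exact: D0.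
- by rewrite linear0 mul0r rpred0.
- exact: DB.
- by rewrite linearB mulrBl rpredB.
Qed.

Lemma dot_half x : dot x h = total x / 2.
Proof.
rewrite /total mulr_suml; apply: eq_bigr => i _.
by rewrite mxE mul1r.
Qed.

Lemma dual_rootE8 : dual (rootE8 R) = rootE8 R.
Proof.
apply/seteqP; split=> x.
  move=> [_ xint]; apply/rootE8E; split; last first.
    by rewrite -dot_half; apply/xint/rootE8_half.
  split=> [|y /rootD_sub_rootE8]; last exact: xint.
  exact: spanR_rootD.
move=> /rootE8E[[_ xint] tx]; split=> [|y].
  exact/spanR_rootD/rootD_sub_rootE8.
move=> [/xint//|[d Dd <-]].
by rewrite linearD /= rpredD ?dot_half // xint.
Qed.

Lemma rootE8_rho x : rootE8 R x -> rootE8 R (rho x).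
Proof.
move=> /rootE8E[Dx tx]; apply/rootE8E.
by split; [apply: dual_rootD_rho | rewrite total_rho].
Qed.

(** Subtracting 2 x_7 times the glue vector (1, ..., 1) / 2 from x in E_8 leaves
an element of D_8 whose last coordinate is zero. *)
Lemma rootE8_lattice : lattice_of_rank 8 (rootE8 R).
Proof.
apply: (glue_lattice (k := 7) (g := h)) => //.
- by rewrite mxE; apply/eqP; lra.
- exact: subgroup_rootE8.
- exact: rootE8_half.
- by move=> i; apply/rootD_sub_rootE8/rootD_evecD.
move=> x /rootE8E[/dual_rootDE[xint x2] xt] /=; rewrite mxE.
have -> : x 0 ord_max / (1 / 2) = x 0 ord_max + x 0 ord_max by field.
have cE j : (x - (x 0 ord_max + x 0 ord_max) *: h) 0 j = x 0 j - x 0 ord_max.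
  by rewrite rowBE rowZE mxE; field.
split=> // [|j lej]; last first.
  rewrite cE (_ : j = ord_max) ?subrr //; apply: val_inj => /=.
  by have := ltn_ord j; lia.
apply/rootDE; split=> [j|]; first by rewrite cE.
rewrite linearB linearZ /= mulrBl -mulrA total_half.
by rewrite rpredB // rpredM // natr_int.
Qed.

Lemma rootE8_cyclic : cyclic_lattice (rootE8 R).
Proof. by have [] := cyclic_of_rank rootE8_lattice rootE8_rho. Qed.

Lemma rootE8_not_simple_cyclic : ~ simple_cyclic (rootE8 R).
Proof.
apply: not_simple_cyclic => //; first exact: rootD_sub_rootE8.
by move=> z /rootE8E[].
Qed.

Lemma dot_e8 x k : (k < 8)%N -> dot x (e8 R k.+1) = x 0 (inZp k).
Proof.
move=> ltk8; rewrite -dot_evec; congr dot; congr delta_mx.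
by apply: val_inj; rewrite /= inordK ?modn_small.
Qed.

Lemma rootE7E x :
  rootE7 R x <-> rootE8 R x /\ x 0 (inZp 6) = - x 0 ord_max.
Proof.
have max7 : inZp 7 = ord_max :> 'I_8 by apply: val_inj.
rewrite /rootE7 /= linearD /= !dot_e8 // max7.
by split=> -[Ex /eqP]; rewrite ?addr_eq0 => x67; split=> //; apply/eqP;
  rewrite ?addr_eq0.
Qed.

Lemma rootE6E x :
  rootE6 R x <-> rootE7 R x /\ x 0 (inZp 5) = - x 0 ord_max.
Proof.
have max7 : inZp 7 = ord_max :> 'I_8 by apply: val_inj.
rewrite /rootE6 /rootE7 /= !linearD /= !dot_e8 // max7.
split=> [[Ex x6 /eqP]|[[Ex x6] /eqP]]; rewrite -?addr_eq0 => /eqP x5 //.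
by split=> //; apply/eqP; rewrite -addr_eq0 x5.
Qed.

Lemma subgroup_rootE7 : subgroup (rootE7 R).
Proof.
have [E0 EB] := subgroup_rootE8.
split=> [|x y /rootE7E[Ex x6] /rootE7E[Ey y6]]; apply/rootE7E; split.
- exact: E0.
- by rewrite !mxE oppr0.
- exact: EB.
- by rewrite !rowBE x6 y6 opprD.
Qed.

Lemma subgroup_rootE6 : subgroup (rootE6 R).
Proof.
have [E0 EB] := subgroup_rootE7.
split=> [|x y /rootE6E[Ex x6] /rootE6E[Ey y6]]; apply/rootE6E; split.
- exact: E0.
- by rewrite !mxE oppr0.
- exact: EB.
- by rewrite !rowBE x6 y6 opprD.
Qed.

(** The vector (-1, 1, 1, 1, 1, 1, 1, -1) / 2 of E_6. *)
Definition glue : 'rV[R]_8 := h - (e 0 + e 7).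

Lemma glueE i : glue 0 i = 1 / 2 - ((i == 0) || (i == ord_max))%:R.
Proof.
rewrite /glue rowBE !mxE !eqxx /=.
have -> : (i == inZp 0) = (i == 0) by [].
have -> : (i == inZp 7) = (i == ord_max) by rewrite -!val_eqE.
by case: eqP => [->|_]; rewrite ?addr0 ?add0r.
Qed.

Lemma glue_max : glue 0 ord_max = - (1 / 2).
Proof. by rewrite glueE eqxx orbT mulr1n; field. Qed.

Lemma rootE6_glue : rootE6 R glue.
Proof.
have E8glue : rootE8 R glue.
  apply: (subgroup_rootE8).2; first exact: rootE8_half.
  exact/rootD_sub_rootE8/rootD_evecD.
by apply/rootE6E; split; [apply/rootE7E; split=> // |];
  rewrite !glueE -!val_eqE /=; field.
Qed.

Lemma rootE7_glue : rootE7 R glue.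
Proof. by have /rootE6E[] := rootE6_glue. Qed.

(** Rotating the glue vector replaces its last two coordinates (1, -1) / 2 by
(1, 1) / 2. *)
Lemma rho_glue : ~ rootE7 R (rho glue).
Proof.
move=> /rootE7E[_]; rewrite !mxE -!val_eqE /=.
by move/eqP; apply/negP/eqP; lra.
Qed.

Lemma rootE7_not_cyclic : ~ cyclic_lattice (rootE7 R).
Proof.
move=> [_ rhoE]; apply: rho_glue; rewrite -rhoE.
by exists glue => //; apply: rootE7_glue.
Qed.

Lemma rootE6_not_cyclic : ~ cyclic_lattice (rootE6 R).
Proof.
move=> [_ rhoE]; apply: rho_glue.
suff /rootE6E[] : rootE6 R (rho glue) by [].
by rewrite -rhoE; exists glue => //; apply: rootE6_glue.
Qed.

(** The coefficient c is -2 times the last coordinate, so subtracting c times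
the glue vector adds the last coordinate to the middle coordinates and
subtracts it from the other two.  This makes all of them integral and changes
the total by an even integer. *)
Lemma rootE8_sub_glue (x : 'rV[R]_8) (c := x 0 ord_max / glue 0 ord_max) :
  rootE8 R x ->
  [/\ c \is a Num.int, rootD R 8 (x - c *: glue) &
      forall j, j != 0 -> j != ord_max ->
        (x - c *: glue) 0 j = x 0 j + x 0 ord_max].
Proof.
have cE : c = - (x 0 ord_max + x 0 ord_max).
  by rewrite /c glue_max; field.
move=> Ex; have /rootE8E[/dual_rootDE[xint x2] xt] := Ex.
have cint : c \is a Num.int by rewrite cE rpredN.
have Ey : rootE8 R (x - c *: glue).
  apply: (subgroup_rootE8).2 => //; apply: subgroupZ => //.
    exact: subgroup_rootE8.
  by have /rootE7E[] := rootE7_glue.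
have yE j : (x - c *: glue) 0 j =
    x 0 j + x 0 ord_max + ((j == 0) || (j == ord_max))%:R * c.
  rewrite rowBE rowZE glueE cE; case: (_ || _); rewrite /= ?mulr1n ?mulr0n.
    by field.
  by field.
split=> // [|j /negPf j0 /negPf jmax]; last by rewrite yE j0 jmax mul0r addr0.
have /rootE8E[_ yt] := Ey; apply/rootDE; split=> // j.
rewrite yE; apply: rpredD; last by rewrite rpredM ?natr_int.
by rewrite -(subrK (x 0 ord_max) (x 0 j)) -addrA rpredD.
Qed.

Lemma rootE7_lattice : lattice_of_rank 7 (rootE7 R).
Proof.
apply: (glue_lattice (k := 6) (g := glue)) => //.
- by rewrite glue_max; apply/eqP; lra.
- exact: subgroup_rootE7.
- exact: rootE7_glue.
- move=> i; apply/rootE7E; split; first exact/rootD_sub_rootE8/rootD_evecD.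
  have := ltn_ord i; rewrite !mxE -!val_eqE /= => lti.
  by rewrite modn_small ?gtn_eqF ?addr0 ?oppr0 //; lia.
move=> x /rootE7E[Ex x6] c.
have [cint Dy yE] := rootE8_sub_glue Ex; split=> // j le6j.
have [->|jmax] := eqVneq j ord_max.
  by rewrite rowBE rowZE divfK ?subrr // glue_max; apply/eqP; lra.
rewrite yE //; last by rewrite -val_eqE /=; lia.
rewrite (_ : j = inZp 6) ?x6 ?addNr //; apply: val_inj => /=.
by move: jmax (ltn_ord j); rewrite -val_eqE /=; lia.
Qed.

Lemma rootE6_lattice : lattice_of_rank 6 (rootE6 R).
Proof.
apply: (glue_lattice (k := 5) (g := glue)) => //.
- by rewrite glue_max; apply/eqP; lra.
- exact: subgroup_rootE6.
- exact: rootE6_glue.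
- move=> i; apply/rootE6E; split; first (apply/rootE7E; split).
  + exact/rootD_sub_rootE8/rootD_evecD.
  + have := ltn_ord i; rewrite !mxE -!val_eqE /= => lti.
    by rewrite modn_small ?gtn_eqF ?addr0 ?oppr0 //; lia.
  have := ltn_ord i; rewrite !mxE -!val_eqE /= => lti.
  by rewrite modn_small ?gtn_eqF ?addr0 ?oppr0 //; lia.
move=> x /rootE6E[/rootE7E[Ex x6] x5] c.
have [cint Dy yE] := rootE8_sub_glue Ex; split=> // j le5j.
have [->|jmax] := eqVneq j ord_max.
  by rewrite rowBE rowZE divfK ?subrr // glue_max; apply/eqP; lra.
rewrite yE //; last by rewrite -val_eqE /=; lia.
have [->|j5] := eqVneq j (inZp 5); first by rewrite x5 addNr.
rewrite (_ : j = inZp 6) ?x6 ?addNr //; apply: val_inj => /=.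
by move: jmax j5 (ltn_ord j); rewrite -!val_eqE /=; lia.
Qed.

End RootE.

Theorem theorem1p3 (R : realType) :
  [/\ (forall n : nat, (2 <= n)%N ->
         simple_cyclic_of_rank n (rootA R n) /\
         simple_cyclic_of_rank n (dual (rootA R n))),
      (forall n : nat, (2 <= n)%N ->
         [/\ cyclic_lattice_of_rank n (rootD R n),
             cyclic_lattice_of_rank n (dual (rootD R n)),
             simple_cyclic (rootD R n) <-> odd n &
             simple_cyclic (dual (rootD R n)) <-> odd n]),
      [/\ dual (rootE8 R) = rootE8 R,
          cyclic_lattice (rootE8 R) &
          ~ simple_cyclic (rootE8 R)] &
      (lattice (rootE6 R) /\ rootE6 R `<=` rootE8 R /\
         ~ cyclic_lattice (rootE6 R)) /\
      (lattice (rootE7 R) /\ rootE7 R `<=` rootE8 R /\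
         ~ cyclic_lattice (rootE7 R))].
Proof.
split.
- move=> n _; split; first exact: rootA_simple_cyclic.
  exact: dual_rootA_simple_cyclic.
- case=> [//|m] m_gt0; split.
  + exact: rootD_cyclic.
  + exact: dual_rootD_cyclic.
  + split=> [Dsimple|modd]; last by exists m.+1; apply: rootD_simple_cyclic.
    apply: contraT => meven.
    case: (not_simple_cyclic m_gt0 meven _ _ Dsimple) => //.
    by move=> z /rootDE[].
  + split=> [Dsimple|modd].
      apply: contraT => meven.
      by case: (dual_rootD_not_simple_cyclic meven Dsimple).
    exists m.+1; split; first exact: dual_rootD_cyclic.
    exact/dual_simple_cyclic/rootD_simple_cyclic.
- split; [exact: dual_rootE8 | exact: rootE8_cyclic |].
  exact: rootE8_not_simple_cyclic.
- split; (split; [|split]).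
  + by exists 6; apply: rootE6_lattice.
  + by move=> x /rootE6E[/rootE7E[]].
  + exact: rootE6_not_cyclic.
  + by exists 7; apply: rootE7_lattice.
  + by move=> x /rootE7E[].
  + exact: rootE7_not_cyclic.
Qed.
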